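(* Let $X$ be a topological space. (1) If $\kappa$ is a regular cardinal such that $\widehat{s}(X) \le \kappa \le \Delta(X)$, then $X$ is $\kappa$-resolvable. (2) Consequently, if $\Delta(X) \ge \operatorname{rs}(X)$, then $X$ is maximally resolvable. (3) In particular, if $X$ has countable spread (i.e. every discrete subspace of $X$ is countable) and $\Delta(X) > \omega$, then $X$ is maximally resolvable.
   Context: No separation axioms are assumed. For a cardinal $\kappa>1$, a topological space is $\kappa$-resolvable if it contains $\kappa$ many pairwise disjoint dense subsets. $\tau^*(X)$ denotes the family of nonempty open subsets of $X$. The dispersion character of $X$ is $\Delta(X)=\min\{|G| : G\in\tau^*(X)\}$. $X$ is maximally resolvable if it is $\Delta(X)$-resolvable. A discrete subset of $X$ is a subset that is discrete in its subspace topology. $\widehat{s}(X)$ is the smallest uncountable cardinal $\lambda$ such that $X$ has no discrete subset of size $\lambda$. $\operatorname{rs}(X)$ is the smallest uncountable regular cardinal $\lambda$ such that $X$ has no discrete subset of size $\lambda$. *)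

(* Defs.v *)
From mathcomp Require Import all_boot.
From mathcomp Require Import boolp classical_sets functions cardinality.
From mathcomp Require Import topology.

Set Implicit Arguments.
Unset Strict Implicit.
Unset Printing Implicit Defensive.

Local Open Scope classical_set_scope.
Local Open Scope card_scope.

(* A cardinal number is represented by any type having that cardinality, so
   cardinals are only meaningful up to [ceq].  A cardinal invariant defined as
   the least cardinal with some property is therefore a predicate saying which
   types represent it. *)
Definition cardinal := Type.

Definition cle (k l : cardinal) : Prop := [set: k] #<= [set: l].
Definition ceq (k l : cardinal) : Prop := [set: k] #= [set: l].
Definition clt (k l : cardinal) : Prop := cle k l /\ ~ cle l k.

Definition card_of (T : Type) (A : set T) : cardinal := set_type A.

Definition is_least_cardinal (P : cardinal -> Prop) (k : cardinal) : Prop :=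
  P k /\ forall l : cardinal, P l -> cle k l.

Definition uncountable_cardinal (k : cardinal) : Prop := clt nat k.

(* k is infinite and is not the union of fewer than k sets, each of
   cardinality less than k; equivalently, cf k = k. *)
Definition regular_cardinal (k : cardinal) : Prop :=
  cle nat k /\
  forall (I : cardinal) (A : I -> set k),
    clt I k -> (forall i, clt (card_of (A i)) k) -> \bigcup_i A i <> [set: k].

(* [set_type A] carries the subspace topology. *)
Definition discrete_subset (X : topologicalType) (A : set X) : Prop :=
  forall U : set (set_type A), open U.

Definition has_discrete_subset_of_size (X : topologicalType) (k : cardinal) :
    Prop :=
  exists A : set X, discrete_subset A /\ ceq (card_of A) k.

(* k = \widehat{s}(X) *)
Definition is_hat_s (X : topologicalType) (k : cardinal) : Prop :=
  is_least_cardinal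
    (fun l => uncountable_cardinal l /\ ~ has_discrete_subset_of_size X l) k.

(* k = rs(X) *)
Definition is_rs (X : topologicalType) (k : cardinal) : Prop :=
  is_least_cardinal
    (fun l => [/\ uncountable_cardinal l, regular_cardinal l
                & ~ has_discrete_subset_of_size X l]) k.

(* k = \Delta(X); no k qualifies when X is empty, the minimum then being
   undefined. *)
Definition is_dispersion_character (X : topologicalType) (k : cardinal) :
    Prop :=
  is_least_cardinal
    (fun l => exists G : set X, [/\ open G, G !=set0 & ceq (card_of G) l]) k.

Definition resolvable (X : topologicalType) (k : cardinal) : Prop :=
  exists F : set (set X),
    [/\ ceq (card_of F) k, (forall D, F D -> dense D) & trivIset F id].

Definition maximally_resolvable (X : topologicalType) : Prop :=
  exists2 k : cardinal, is_dispersion_character X k & resolvable X k.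

Definition countable_spread (X : topologicalType) : Prop :=
  forall A : set X, discrete_subset A -> countable A.

(* Main.v *)
Require Import Defs.
From Stdlib Require Import Wellfounded.Inverse_Image.
From mathcomp Require Import all_boot.
From mathcomp Require Import boolp classical_sets functions cardinality wochoice.
From mathcomp Require Import topology.

Set Implicit Arguments.
Unset Strict Implicit.
Unset Printing Implicit Defensive.

Local Open Scope classical_set_scope.
Local Open Scope card_scope.

(* It suffices to find, inside every nonempty open set, a nonempty subspace
   split into kappa disjoint sets each dense in that subspace: a maximal family
   of kappa disjoint sets with a common closure is then dense.

   Regular kappa.  If, for every M of size < kappa, some S of size < kappa
   avoiding M is dense in W, dense sets are picked one after the other.
   Otherwise W contains a left-separated family (x w) indexed by kappa * kappa.
   Let I be the kappa-complete ideal of the sets with fewer than kappa columns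
   of size kappa.  The points y for which some A in I meets every B in I that
   accumulates at y form a set R of I: otherwise one extracts from R, one point
   per column, a right-separated sequence of length kappa, which is also
   left-separated and hence discrete.  Outside R, a recursion of length kappa
   distributes disjoint members of I, each accumulating at a prescribed point.

   Singular lambda = |W| = Delta(W) > rho, rho regular, without discrete sets
   of size rho.  For an infinite cardinal k < lambda let F_k be the largest
   subset of W each of whose points is accumulated, off any set of size k, by a
   subset of F_k of size at most rho.  Subsets of W \ F_k have density at most
   k, so if some F_k is not dense, disjoint dense sets of size k can be picked
   in an open set missing it.  Otherwise take k_i cofinal in lambda and choose
   disjoint Y_i in F_(k_i), of size at most k_(i+1), each k_i-resolvable and
   such that the union of the Y_j, j >= i, is dense for every i.

   For an arbitrary Delta(X) both cases are applied to open sets of locally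
   minimal cardinality. *)

(** * Well-orders and cardinal arithmetic *)

Lemma inj_on_card_le T U (A : set T) (B : set U) (f : T -> U) :
  (forall x, A x -> B (f x)) ->
  (forall x y, A x -> A y -> f x = f y -> x = y) -> A #<= B.
Proof.
move=> fAB finj.
have finj' : {in A &, injective f}.
  by move=> x y /set_mem Ax /set_mem Ay; exact: finj.
rewrite -(card_le_eql (inj_card_eq finj')).
by apply: subset_card_le => _ [x Ax <-]; exact: fAB.
Qed.

Lemma card_le_inj_on T U (A : set T) (B : set U) : A #<= B -> A !=set0 ->
  exists f : T -> U, (forall x, A x -> B (f x)) /\
    (forall x y, A x -> A y -> f x = f y -> x = y).
Proof.
move=> leAB [a Aa].
have /card_leP[g] := leAB.
pose f x := if pselect (A x) is left Ax then val (g (SigSub (mem_set Ax)))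
            else val (g (SigSub (mem_set Aa))).
exists f; rewrite /f; split=> [x Ax|x y Ax Ay].
  by case: pselect => // Ax'; exact: set_valP.
case: pselect => // Ax'; case: pselect => // Ay' /val_inj.
by move=> /(@inj _ _ _ g); rewrite !in_setT => /(_ isT isT) [].
Qed.

Lemma card_le_surj_on T U (A : set T) (B : set U) : A #<= B -> A !=set0 ->
  exists f : U -> T, forall x, A x -> exists2 y, B y & f y = x.
Proof.
move=> leAB A0; have [g [gB ginj]] := card_le_inj_on leAB A0.
case: A0 => a Aa.
pose f y := @xget {classic T} a [set x | A x /\ g x = y].
exists f => x Ax; exists (g x); first exact: gB.
rewrite /f; case: xgetP => [_ -> [Az /ginj]|/(_ x)[]//]; exact.
Qed.

Definition seg T (lt : T -> T -> Prop) (t : T) : set T := [set s | lt s t].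

Record strict_well_order T (lt : T -> T -> Prop) : Prop := StrictWellOrder {
  swo_wf : well_founded lt;
  swo_trans : forall x y z, lt x y -> lt y z -> lt x z;
  swo_total : forall x y, [\/ lt x y, x = y | lt y x] }.

Lemma wf_min T (lt : T -> T -> Prop) (P : set T) : well_founded lt ->
  P !=set0 -> exists2 x, P x & forall y, lt y x -> ~ P y.
Proof.
move=> wf [x Px]; apply: contrapT => noP.
elim/(well_founded_ind wf): x Px => x IH Px.
by apply: noP; exists x => // y yx /(IH y yx).
Qed.

Lemma strict_well_order_exists T : exists lt, @strict_well_order T lt.
Proof.
have [R woR] := well_ordering_principle {classic T}.
have woC : {in <= predT, well_order R} by exact: withinW.
have Rtot x y : R x y || R y x by exact: (wo_chainW woC).
have Ranti x y : R x y -> R y x -> x = y.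
  by move=> xy yx; apply: (wo_chain_antisymmetric woC) => //; rewrite xy yx.
have Rmin (P : set T) : P !=set0 -> exists2 z, P z & forall x, P x -> R z x.
  move=> [x Px]; have [|z [[zP lb] _]] := woR [pred x | `[<P x>]].
    by exists x; apply/asboolP.
  exists z; first exact/asboolP.
  by move=> y Py; apply: lb; apply/asboolP.
(* Transitivity is read off from the least element of [[set x; y; z]]. *)
have Rtr x y z : R x y -> R y z -> R x z.
  move=> xy yz; have [|w] := Rmin [set x; y; z]; first by exists x; left; left.
  move=> [[]|] -> lb; first by apply: lb; right.
    by have <- : y = x by apply: Ranti => //; apply: lb; left; left.
  have <- : y = z by apply: Ranti => //; apply: lb; left; right.
  by [].
exists (fun x y => R x y /\ x <> y); split=> [x|x y z [xy nxy] [yz nyz]|x y].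
- apply: contrapT => nacc.
  have [|z nz lb] := Rmin [set x | ~ Acc (fun x y => R x y /\ x <> y) x].
    by exists x.
  apply: nz; constructor => y [yz nyz]; apply: contrapT => /lb zy.
  by apply: nyz; exact: Ranti.
- split; first exact: Rtr yz.
  by move=> xz; apply: nxy; apply: Ranti => //; rewrite xz.
- have [->|nxy] := pselect (x = y); first by constructor 2.
  have /orP[xy|yx] := Rtot x y; first by constructor 1.
  by constructor 3; split=> // /esym.
Qed.

(* The value at [k] depends on the earlier values only through their range. *)
Lemma wf_choice K T (lt : K -> K -> Prop) (Q : set T) (P : K -> set T -> T -> Prop) :
  well_founded lt ->
  (forall k S, S `<=` Q -> S #<= seg lt k -> exists2 t, Q t & P k S t) ->
  exists f : K -> T, forall k, Q (f k) /\ P k (f @` seg lt k) (f k).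
Proof.
move=> wf ex.
have [[k0 _]|nK] := pselect (exists k : K, True); last first.
  by exists (fun k => False_rect T (nK (ex_intro _ k I))) => k; case: nK; exists k.
have [t0 _ _] : exists2 t, Q t & P k0 set0 t by apply: ex.
pose F k (rec : forall j, lt j k -> T) : T :=
  @xget {classic T} t0 [set t | Q t /\ P k [set s | exists j (jk : lt j k), rec j jk = s] t].
pose f := Fix wf (fun=> T) F.
have fE k : f k = @xget {classic T} t0 [set t | Q t /\ P k (f @` seg lt k) t].
  rewrite /f Fix_eq; last first.
    move=> x g h gh; congr (@xget {classic T} t0 _); congr (fun S => [set t | Q t /\ P x S t]).
    apply/seteqP; split=> s [j [jx <-]]; exists j, jx; by rewrite gh.
  rewrite /F; congr (@xget {classic T} t0 _); congr (fun S => [set t | Q t /\ P k S t]).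
  by apply/seteqP; split=> [s [j [jk <-]]|s [j jk <-]]; [exists j|exists j, jk].
exists f; elim/(well_founded_ind wf) => k IH.
have [||t Qt Pt] := ex k (f @` seg lt k).
- by move=> _ [j /IH[Qj _] <-].
- exact: card_image_le.
have := fE k; case: xgetP => [s -> []|/(_ t)[]//].
by move=> Qs Ps ->.
Qed.

Lemma card_le_segs K U (lt : K -> K -> Prop) (D : set K) (B : set U) :
  strict_well_order lt -> (forall t, D t -> ~ (B #<= seg lt t)) -> D #<= B.
Proof.
move=> wo nB.
have [[b0 Bb0]|B0] := pselect (B !=set0); last first.
  suff -> : D = set0 by exact: card_ge0.
  apply/seteqP; split=> // t /nB[]; suff -> : B = set0 by exact: card_ge0.
  by apply/seteqP; split=> // b Bb; apply: B0; exists b.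
have [|f fP] := @wf_choice K U lt B (fun t S u => D t -> ~ S u) (swo_wf wo).
  move=> t S SB Sle; have [Dt|nDt] := pselect (D t); last by exists b0.
  apply: contrapT => noU; apply: (nB t Dt); apply: card_le_trans Sle.
  apply: subset_card_le => u Bu; apply: contrapT => nSu.
  by apply: noU; exists u.
apply: (@inj_on_card_le _ _ _ _ f) => [x _|x y Dx Dy fxy]; first by have [] := fP x.
have [xy|//|yx] := swo_total wo x y.
  by have [_ /(_ Dy)[]] := fP y; exists x.
by have [_ /(_ Dx)[]] := fP x; exists y.
Qed.

Lemma card_le_total T U (A : set T) (B : set U) : A #<= B \/ B #<= A.
Proof.
have [lt wo] := strict_well_order_exists (set_type A).
have [[t Bt]|nB] := pselect (exists t, B #<= seg lt t).
  right; apply: card_le_trans Bt (card_le_trans (card_leT _) _).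
  by have := card_setT A; rewrite card_eq_le => /andP[].
left; apply: (@card_le_trans _ _ _ [set: set_type A]).
  by have := card_setT A; rewrite card_eq_le => /andP[].
by apply: card_le_segs wo _ => t _ Bt; apply: nB; exists t.
Qed.

Lemma card_ltW T U (A : set T) (B : set U) : ~ (A #<= B) -> B #<= A.
Proof. by have [] := card_le_total A B. Qed.

Lemma swo_preimage T U (lt : U -> U -> Prop) (g : T -> U) : strict_well_order lt ->
  injective g -> strict_well_order (fun x y => lt (g x) (g y)).
Proof.
move=> wo ginj; split=> [|x y z|x y].
- exact: wf_inverse_image (swo_wf wo).
- exact: swo_trans.
- by have [|/ginj->|] := swo_total wo (g x) (g y);
    [constructor 1|constructor 2|constructor 3].
Qed.

(** The order type is the initial ordinal of [K], so a recursion along [lt] has fewer than [K]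
    earlier stages at each stage. *)
Definition initial_order K (lt : K -> K -> Prop) :=
  strict_well_order lt /\ forall k, ~ ([set: K] #<= seg lt k).

(** If some segment of a well-order has full size, the least such segment is pulled back along an
    injection of [K] into it. *)
Lemma initial_order_exists K : exists lt, @initial_order K lt.
Proof.
have [R woR] := strict_well_order_exists K.
have [[k Kk]|nK] := pselect (exists k, [set: K] #<= seg R k); last first.
  by exists R; split=> // k Kk; apply: nK; exists k.
have [k0 Kk0 kmin] := wf_min (swo_wf woR) (ex_intro [set k | [set: K] #<= seg R k] k Kk).
have [g [gk ginj]] := card_le_inj_on Kk0 (ex_intro _ k I).
exists (fun x y => R (g x) (g y)); split.
  by apply: swo_preimage => // x y; exact: ginj.
move=> x Kx; apply: (kmin (g x) (gk x I)) => /=.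
apply: card_le_trans Kx _; apply: (@inj_on_card_le _ _ _ _ g) => [y //|y z _ _].
exact: ginj.
Qed.

Lemma card_lt_seg K U (lt : K -> K -> Prop) (B : set U) : strict_well_order lt ->
  ~ ([set: K] #<= B) -> exists k, B #<= seg lt k.
Proof.
move=> wo nB; apply: contrapT => nex; apply: nB; apply: card_le_segs wo _ => t _ Bt.
by apply: nex; exists t.
Qed.

(** Cardinals below [A0] are measured by segments of a well-order of [A0]; a member that fits into
    the least segment bounding some member is smallest. *)
Lemma card_min T (F : set (set T)) : F !=set0 ->
  exists2 A, F A & forall B, F B -> A #<= B.
Proof.
move=> [A0 FA0]; have [lt wo] := strict_well_order_exists (set_type A0).
have [A0min|] := pselect (forall B, F B -> A0 #<= B); first by exists A0.
move=> /existsNP[B /not_implyP[FB nA0B]].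
have [|k Bk] := @card_lt_seg _ _ lt B wo.
  by rewrite (card_le_eql (card_setT A0)).
have [|k0 [A FA Ak0] kmin] :=
  @wf_min _ lt [set k | exists2 B, F B & B #<= seg lt k] (swo_wf wo).
  by exists k; exists B.
exists A => // B' FB'; apply: contrapT => nAB'; apply: nAB'.
apply: card_le_trans Ak0 _; apply: card_le_segs wo _ => t tk B't.
by apply: (kmin t tk); exists B'.
Qed.

Lemma swo_lex T U (ltT : T -> T -> Prop) (ltU : U -> U -> Prop) :
  strict_well_order ltT -> strict_well_order ltU ->
  strict_well_order (fun p q : T * U => ltT p.1 q.1 \/ p.1 = q.1 /\ ltU p.2 q.2).
Proof.
move=> woT woU; split=> [[x y]|[x y] [x' y'] [x'' y'']|[x y] [x' y']] /=.
- elim/(well_founded_ind (swo_wf woT)): x y => x IHx y.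
  elim/(well_founded_ind (swo_wf woU)): y => y IHy.
  by constructor=> -[x' y'] /= [/IHx//|[-> /IHy]].
- move=> [xx'|[-> yy']] [xx''|[<- yy'']]; [left|left|by left|right].
  + exact: swo_trans xx' xx''.
  + by [].
  + by split=> //; exact: swo_trans yy' yy''.
- have [xx'|<-|xx'] := swo_total woT x x'; [by constructor 1; left| |by constructor 3; left].
  have [yy'|<-|yy'] := swo_total woU y y'; last by constructor 3; right.
  + by constructor 1; right.
  + by constructor 2.
Qed.

Lemma card_set_type T (A : set T) U (B : set U) :
  ([set: set_type A] #<= B) = (A #<= B).
Proof. exact: card_le_eql (card_setT A). Qed.

Lemma card_set_type_r T (A : set T) U (B : set U) :
  (B #<= [set: set_type A]) = (B #<= A).
Proof. exact: card_le_eqr (card_setT A). Qed.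

Lemma infinite_card_le T U (A : set T) (B : set U) :
  A #<= B -> infinite_set A -> infinite_set B.
Proof. by move=> AB; apply: contra_not; exact: card_le_finite. Qed.

(** Hilbert's hotel: a shift along a copy of [nat] inside [A] makes room for [x]. *)
Lemma card_setU1_le T (A : set T) x : infinite_set A -> A `|` [set x] #<= A.
Proof.
move=> /infiniteP/card_le_inj_on[|f [fA finj]]; first by exists 0.
have [Ax|nAx] := pselect (A x).
  by apply: subset_card_le => _ [//|->].
pose h z := if pselect (z = x) then f 0 else
  if pselect (exists n, f n = z) is left e then f (projT1 (cid e)).+1 else z.
have hx : h x = f 0 by rewrite /h; case: pselect.
have hf n : h (f n) = f n.+1.
  rewrite /h; case: pselect => /= [fx|_]; first by case: nAx; rewrite -fx; exact: fA.
  case: pselect => [e|[]]; last by exists n.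
  by case: cid => m /= /finj->.
have hN z : A z -> ~ (exists n, f n = z) -> h z = z.
  move=> Az nz; rewrite /h; case: pselect => /= [zx|_]; first by case: nAx; rewrite -zx.
  by case: pselect.
have hcase z : (A `|` [set x]) z ->
    [\/ z = x, exists n, z = f n | A z /\ ~ exists n, f n = z].
  move=> [Az|->]; last by constructor 1.
  have [[n <-]|nz] := pselect (exists n, f n = z); last by constructor 3.
  by constructor 2; exists n.
apply: (@inj_on_card_le _ _ _ _ h) => [z|z w].
  move=> /hcase[->|[n ->]|[Az nz]]; rewrite ?hx ?hf ?hN //; exact: fA.
move=> /hcase[->|[n ->]|[Az nz]] /hcase[->|[m ->]|[Aw nw]] //.
- by rewrite hx hf => /finj -/(_ I I).
- by rewrite hx hN// => fw; case: nw; exists 0.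
- by rewrite hx hf => /finj -/(_ I I).
- by rewrite !hf => /finj -/(_ I I)[->].
- by rewrite hf hN// => fw; case: nw; exists n.+1.
- by rewrite hx hN// => fw; case: nz; exists 0.
- by rewrite hf hN// => fw; case: nz; exists m.+1.
- by rewrite !hN.
Qed.

(** Hessenberg's theorem. In a counterexample [A] of least size, pairs are ordered by their maximum
    first, then lexicographically. Each segment then lies in the square of a proper initial part [S]
    of [A], which is finite or, by minimality, no larger than [S]. *)
Lemma infinite_square T : infinite_set [set: T] -> [set: T * T] #<= [set: T].
Proof.
move=> Tinf; apply: contrapT => nT.
have [|A [Ainf nA] Amin] :=
  @card_min _ [set B : set T | infinite_set B /\ ~ (B `*` B #<= B)].
  by exists setT; split=> //; rewrite setXTT.
have [lt [wo ltA]] := initial_order_exists (set_type A).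
have sq (S : set (set_type A)) : infinite_set S -> ~ ([set: set_type A] #<= S) ->
    S `*` S #<= S.
  move=> Sinf nS; apply: contrapT => nSS; apply: nS; rewrite card_set_type.
  have SE : val @` S #= S by apply: inj_card_eq => x y _ _; exact: val_inj.
  rewrite -(card_le_eqr SE); apply: Amin; split.
    by apply: contra_not Sinf; rewrite (eq_finite_set SE).
  rewrite (card_le_eqr SE); apply: contra_not nSS; apply: card_le_trans.
  apply: (@inj_on_card_le _ _ _ _ (fun p => (val p.1, val p.2))).
    by move=> [x y] [/= Sx Sy]; split; [exists x|exists y].
  by move=> [x y] [x' y'] _ _ /= [/val_inj-> /val_inj->].
pose max (p : set_type A * set_type A) := if pselect (lt p.1 p.2) then p.2 else p.1.
have wo3 := swo_lex wo (swo_lex wo wo).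
have := swo_preimage wo3 (_ : injective (fun p => (max p, p))).
move=> /(_ (fun p q => @congr1 _ _ snd _ _)); set lt2 := fun p q => _ => wo2.
apply: nA; rewrite -(card_set_type_r A).
apply: (@card_le_trans _ _ _ [set: set_type A * set_type A]).
  have [g [_ ginj]] : exists f : T -> set_type A, (forall x, A x -> True) /\
      (forall x y, A x -> A y -> f x = f y -> x = y).
    have A0 := infinite_setN0 Ainf.
    have [|f [_ finj]] := @card_le_inj_on _ _ A [set: set_type A] _ A0.
      by rewrite card_set_type_r card_lexx.
    by exists f.
  apply: (@inj_on_card_le _ _ _ _ (fun p => (g p.1, g p.2))) => //.
  by move=> [x y] [x' y'] [/= ? ?] [/= ? ?] [/ginj-> // /ginj->].
apply: card_le_segs wo2 _ => p _.
pose S := [set s | lt s (max p) \/ s = max p].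
have segS : seg lt2 p `<=` S `*` S.
  have maxl (q : set_type A * set_type A) : lt q.1 (max q) \/ q.1 = max q.
    by rewrite /max; case: pselect; [left|right].
  have maxr (q : set_type A * set_type A) : lt q.2 (max q) \/ q.2 = max q.
    rewrite /max; case: pselect => /= [_|n12]; first by right.
    by have [//|e|] := swo_total wo q.1 q.2; [right|left].
  have up a q : lt a (max q) \/ a = max q -> lt2 q p -> S a.
    move=> ha [h|[/= h _]]; last by rewrite /S /= -h.
    by left; case: ha => [ha|->//]; exact: swo_trans ha h.
  by move=> q qp; split; [apply: up (maxl q) qp|apply: up (maxr q) qp].
have Sfin : infinite_set S -> ~ ([set: set_type A] #<= S).
  move=> Sinf leS; apply: (ltA (max p)); apply: card_le_trans leS _.
  have -> : S = seg lt (max p) `|` [set max p] by [].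
  apply: card_setU1_le; apply: contra_not Sinf => fin.
  by rewrite (_ : S = seg lt (max p) `|` [set max p])// finite_setU.
move=> leA.
have {leA}leA : [set: set_type A] #<= S `*` S.
  exact: card_le_trans leA (subset_card_le segS).
have [Sf|Si] := pselect (finite_set S).
  apply: Ainf; rewrite -(eq_finite_set (card_setT A)).
  exact: card_le_finite leA (finite_setX Sf Sf).
by apply: Sfin (Si) (card_le_trans leA (sq _ Si (Sfin Si))).
Qed.

Lemma card_setX_le T U V (A : set T) (B : set U) (C : set V) :
  infinite_set C -> A #<= C -> B #<= C -> A `*` B #<= C.
Proof.
move=> Cinf AC BC; have [[[a b] [/= Aa Bb]]|AB0] := pselect (A `*` B !=set0); last first.
  suff -> : A `*` B = set0 by exact: card_ge0.
  by apply/seteqP; split=> // p ABp; apply: AB0; exists p.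
have [||f [fC finj]] := @card_le_inj_on _ _ A [set: set_type C];
  [by rewrite card_set_type_r|by exists a|].
have [||g [gC ginj]] := @card_le_inj_on _ _ B [set: set_type C];
  [by rewrite card_set_type_r|by exists b|].
rewrite -(card_set_type_r C).
have Cinf' : infinite_set [set: set_type C].
  by rewrite (eq_finite_set (card_setT C)).
apply: card_le_trans (infinite_square Cinf').
apply: (@inj_on_card_le _ _ _ _ (fun p => (f p.1, g p.2))) => //.
by move=> [x y] [x' y'] [/= Ax By] [/= Ax' By'] [/finj-> // /ginj->].
Qed.

Lemma card_bigcup_le I T V (J : set I) (A : I -> set T) (C : set V) :
  infinite_set C -> J #<= C -> (forall j, J j -> A j #<= C) ->
  \bigcup_(j in J) A j #<= C.
Proof.
move=> Cinf JC AC.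
have [c0 Cc0] := infinite_setN0 Cinf.
have /choice[f fP] : forall j, exists f : T -> V, J j ->
    (forall x, A j x -> C (f x)) /\ (forall x y, A j x -> A j y -> f x = f y -> x = y).
  move=> j; have [Jj|nJ] := pselect (J j); last by exists (fun=> c0).
  have [A0|A0] := pselect (A j !=set0).
    by have [f fP] := card_le_inj_on (AC j Jj) A0; exists f.
  by exists (fun=> c0) => _; split=> [x Ax|x y Ax]; case: A0; exists x.
have [[x0 [j0 Jj0 _]]|U0] := pselect (\bigcup_(j in J) A j !=set0); last first.
  suff -> : \bigcup_(j in J) A j = set0 by exact: card_ge0.
  by apply/seteqP; split=> // x Ux; apply: U0; exists x.
have /choice[i iP] : forall x, exists j, (\bigcup_(j in J) A j) x -> J j /\ A j x.
  move=> x; have [[j Jj Ajx]|nU] := pselect ((\bigcup_(j in J) A j) x); first by exists j.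
  by exists j0.
apply: (card_le_trans _ (card_setX_le Cinf JC (card_lexx C))).
apply: (@inj_on_card_le _ _ _ _ (fun x => (i x, f (i x) x))).
  move=> x /iP[Ji Ax]; split=> //=; exact: (fP _ Ji).1.
move=> x y /iP[Ji Ax] /iP[Ji' Ay] [ixy]; rewrite -ixy => fxy.
by apply: (fP _ Ji).2 fxy; rewrite // ixy.
Qed.

Lemma card_setU_le T V (A B : set T) (C : set V) :
  infinite_set C -> A #<= C -> B #<= C -> A `|` B #<= C.
Proof.
move=> Cinf AC BC; rewrite -bigcup2E; apply: card_bigcup_le => //; first by apply/infiniteP.
by move=> [|[|n]] _ //; exact: card_ge0.
Qed.

(** By comparability of cardinals this says [|S| < |K|]. *)
Definition small K T (S : set T) := ~ ([set: K] #<= S).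

Lemma small_le K T U (A : set T) (B : set U) : A #<= B -> small K B -> small K A.
Proof. by move=> AB; apply: contra_not => KA; exact: card_le_trans AB. Qed.

Lemma smallS K T (A B : set T) : A `<=` B -> small K B -> small K A.
Proof. by move=> AB; apply: small_le; exact: subset_card_le. Qed.

Lemma small_card_leW K T (A : set T) : small K A -> A #<= [set: K].
Proof. exact: card_ltW. Qed.

(** An injection of [K] into the union would pull the sets [A j] back to a cover of [K] that
    regularity forbids. *)
Lemma small_bigcup_regular K L T (J : set L) (A : L -> set T) :
  regular_cardinal K -> small K J -> (forall j, J j -> small K (A j)) ->
  small K (\bigcup_(j in J) A j).
Proof.
move=> [natK regK] Js As leK.
have [k0 _] : [set: K] !=set0 by apply: infinite_setN0; apply/infiniteP.
have [f [fU finj]] := card_le_inj_on leK (ex_intro _ k0 I).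
apply: (regK (set_type J) (fun j => f @^-1` A (val j))).
- rewrite /clt /cle !card_set_type card_set_type_r; split=> //.
  exact: card_ltW.
- move=> [j Jj]; rewrite /clt /cle /card_of !card_set_type card_set_type_r.
  have ns : small K (f @^-1` A j).
    apply: small_le (As j (set_mem Jj)).
    by apply: (@inj_on_card_le _ _ _ _ f) => // x y _ _; exact: finj.
  by split=> //; exact: small_card_leW.
- apply/seteqP; split=> // k _; have [j Jj Aj] := fU k I.
  by exists (SigSub (mem_set Jj)).
Qed.

(** * Discrete sequences and resolutions *)

Lemma setI0_notin T (A B : set T) x : A `&` B = set0 -> A x -> B x -> False.
Proof. by move=> AB Ax Bx; have : (A `&` B) x by []; rewrite AB. Qed.

Section topology.
Variable X : topologicalType.
Implicit Types (A B S W Y Z : set X) (x y : X).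

Lemma closure_meets_open S W x : closure S x -> open W -> W x -> exists2 y, S y & W y.
Proof. by move=> Sx oW Wx; have [|y []] := Sx W; [exact: open_nbhs_nbhs|exists y]. Qed.

Lemma open_closureC S : open (~` closure S).
Proof. by rewrite openC; exact: closed_closure. Qed.

Lemma closure_sub S B : S `<=` closure B -> closure S `<=` closure B.
Proof. by move=> /closureS /subset_trans; apply; exact: closed_closure. Qed.

Lemma discrete_subsetP A : discrete_subset A <->
  forall x, A x -> exists V, [/\ open V, V x & forall y, A y -> V y -> y = x].
Proof.
split=> [dA x Ax|iso U].
  have [V oV VE] := dA [set SigSub (mem_set Ax)].
  have Vx : V x by have : (val @^-1` V) (SigSub (mem_set Ax)) by rewrite VE.
  exists V; split=> // y Ay Vy.
  have : (val @^-1` V) (SigSub (mem_set Ay)) by [].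
  by rewrite VE => -[].
pose V := \bigcup_(W in [set W | open W /\ forall y (Ay : A y), W y ->
  U (SigSub (mem_set Ay))]) W.
exists V; first by apply: bigcup_open => W [].
apply/seteqP; split=> [[x Ax] [W [_ WU] /= Wx]|[x Ax] Ux].
  by have := WU x (set_mem Ax) Wx; rewrite (Prop_irrelevance (mem_set _) Ax).
have [W [oW Wx Wmin]] := iso x (set_mem Ax); exists W => //; split=> // y Ay Wy.
have yx := Wmin y Ay Wy; subst y.
by rewrite (Prop_irrelevance (mem_set _) Ax).
Qed.

Lemma discrete_subsetS A B : B `<=` A -> discrete_subset A -> discrete_subset B.
Proof.
move=> BA /discrete_subsetP dA; apply/discrete_subsetP => x /BA/dA[V [oV Vx Vmin]].
by exists V; split=> // y /BA; exact: Vmin.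
Qed.

(* A sequence that is both left- and right-separated by one order is discrete. *)
Lemma discrete_range K (lt : K -> K -> Prop) (f : K -> X) : strict_well_order lt ->
  (forall k, ~ closure (f @` seg lt k) (f k)) ->
  (forall k, ~ closure (f @` [set j | lt k j]) (f k)) ->
  discrete_subset (range f) /\ [set: K] #<= range f.
Proof.
move=> wo before after; split.
  apply/discrete_subsetP => _ [k _ <-].
  exists (~` closure (f @` seg lt k) `&` ~` closure (f @` [set j | lt k j])).
  split=> [||_ [j _ <-] [nb na]].
  - by apply: openI; exact: open_closureC.
  - by split; [exact: before|exact: after].
  - have [jk|->//|kj] := swo_total wo j k.
    + by case: nb; apply: subset_closure; exists j.
    + by case: na; apply: subset_closure; exists j.
apply: (@inj_on_card_le _ _ _ _ f) => [k _|j k _ _ fjk]; first by exists k.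
have [jk|//|kj] := swo_total wo j k.
  by case: (before k); apply: subset_closure; exists j.
by case: (before j); apply: subset_closure; exists k.
Qed.

(** The pieces need not cover [Z]; all of them have the same closure as [Z]. *)
Definition resolution K Z (D : K -> set X) :=
  [/\ forall k, D k `<=` Z, forall k, Z `<=` closure (D k) & trivIset setT D].

Lemma resolution_set0 K : @resolution K set0 (fun=> set0).
Proof. by split=> [k x []|k x []|j k _ _ [x []]]. Qed.

(* A maximal disjoint family is encoded as a graph in [K * X], so that Zorn's
   lemma for inclusion applies. *)
Lemma resolution_local K Y :
  (forall W y, open W -> W y -> Y y -> exists Z (D : K -> set X),
     [/\ Z !=set0, Z `<=` W `&` Y & resolution Z D]) ->
  exists D : K -> set X, resolution Y D.
Proof.
move=> loc.
pose P (G : set (K * X)) := [/\ forall k j x, G (k, x) -> G (j, x) -> k = j,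
  forall k x, G (k, x) -> Y x &
  forall j k x, G (j, x) -> closure [set y | G (k, y)] x].
have [F FP Ftot|G [[Gdisj GY Gcl] Gmax]] := @Zorn_bigcup _ P.
  split.
  - move=> k j x [A FA Akx] [B FB Bjx].
    have [AB|BA] := Ftot _ _ FA FB.
      by have [disj _ _] := FP B FB; exact: disj (AB _ Akx) Bjx.
    by have [disj _ _] := FP A FA; exact: disj Akx (BA _ Bjx).
  - by move=> k x [A FA Akx]; have [_ + _] := FP A FA; apply; exact: Akx.
  - move=> j k x [A FA Ajx]; have [_ _ /(_ j k x Ajx)] := FP A FA.
    by apply: closureS => y Aky; exists A.
exists (fun k => [set x | G (k, x)]); split=> [k x|k y Yy|j k _ _ [x [/= Gj Gk]]].
- exact: GY.
- apply: contrapT => ny.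
  have [Z [D [[z Zz] ZW [DZ ZD Dtriv]]]] := loc _ y (@open_closureC _) ny Yy.
  pose G' := G `|` [set p | D p.1 p.2].
  apply: (Gmax G').
    split; first by move=> p Gp; left.
    move=> sub; have [|x [Dx _]] := ZD k z Zz setT; first exact: filterT.
    have [nx _] := ZW x (DZ _ _ Dx); apply: nx; apply: subset_closure => /=.
    by apply: sub; right.
  (* Every layer of [G] lies in the closure of the layer [k], so the new pieces, chosen off that
     closure, miss all layers. *)
  have GD j i x : G (j, x) -> D i x -> False.
    by move=> Gjx /DZ/ZW[nx _]; apply: nx; exact: Gcl Gjx.
  split.
  + move=> i j x [Gi|Di] [Gj|Dj]; [exact: Gdisj Gi Gj|by have := GD _ _ _ Gi Dj| |].
      by have := GD _ _ _ Gj Di.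
    by apply: Dtriv => //; exists x.
  + by move=> i x [/GY//|/DZ/ZW[]].
  + move=> i j x [Gi|Di].
      by apply: closureS (Gcl i j x Gi) => z'; left.
    by apply: closureS (ZD j x (DZ _ _ Di)) => z'; right.
- exact: Gdisj Gj Gk.
Qed.

(** The pieces are chosen one by one along [lt]. [Q] records a property, such as a size bound, that
    may be assumed of the pieces already chosen. *)
Lemma resolution_by_dense_sets K (lt : K -> K -> Prop) Z (Q : set (set X)) :
  initial_order lt ->
  (forall F : set (set X), F `<=` Q -> small K F -> exists B,
     [/\ Q B, B `<=` Z, Z `<=` closure B & forall A, F A -> A `&` B = set0]) ->
  exists D : K -> set X, resolution Z D.
Proof.
move=> [wo lts] ex.
have [k F FQ Fle|D DP] := @wf_choice K _ lt Q (fun _ F B =>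
  [/\ B `<=` Z, Z `<=` closure B & forall A, F A -> A `&` B = set0]) (swo_wf wo).
  have [B [QB BZ ZB FB]] := ex F FQ (small_le Fle (lts k)).
  by exists B.
exists D; split=> [k|k|j k _ _ [x [Dj Dk]]]; [by have [_ []] := DP k|by have [_ []] := DP k|].
have [jk|//|kj] := swo_total wo j k.
- by have [_ [_ _ disj]] := DP k; case: (setI0_notin (disj _ _) Dj Dk); exists j.
- by have [_ [_ _ disj]] := DP j; case: (setI0_notin (disj _ _) Dk Dj); exists k.
Qed.

(* Each pair (point of [Z], index) is served at one stage of a recursion of
   length [K], so every point ends up in the closure of every piece. *)
Lemma resolution_by_accumulation K (lt : K -> K -> Prop) Z (Q : set (set X)) :
  initial_order lt -> infinite_set [set: K] -> Z #<= [set: K] ->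
  (forall F : set (set X), F `<=` Q -> small K F -> forall x, Z x -> exists B,
     [/\ Q B, B `<=` Z, closure B x & forall A, F A -> A `&` B = set0]) ->
  exists D : K -> set X, resolution Z D.
Proof.
move=> [wo lts] Kinf ZK ex.
have [[x0 Zx0]|Z0] := pselect (Z !=set0); last first.
  exists (fun=> set0); suff -> : Z = set0 by exact: resolution_set0.
  by apply/seteqP; split=> // x Zx; apply: Z0; exists x.
have [k0 _] := infinite_setN0 Kinf.
have [|e eP] := card_le_surj_on (card_setX_le Kinf ZK (card_lexx [set: K])).
  by exists (x0, k0).
have [B0 [QB0 _ _ _]] :=
  ex set0 (@sub0set _ _) (fun h => Kinf (card_le_finite h (finite_set0 _))) x0 Zx0.
have [k F FQ Fle|B BP] := @wf_choice K _ lt Q (fun k F B => Z (e k).1 ->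
  [/\ B `<=` Z, closure B (e k).1 & forall A, F A -> A `&` B = set0]) (swo_wf wo).
  have [Zk|nZk] := pselect (Z (e k).1); last by exists B0.
  by have [B [QB BZ ekB FB]] := ex F FQ (small_le Fle (lts k)) _ Zk; exists B.
exists (fun j => \bigcup_(k in [set k | (e k).2 = j /\ Z (e k).1]) B k); split.
- by move=> j x [k [_ Zk]]; have [_ /(_ Zk)[BZ _ _]] := BP k; exact: BZ.
- move=> j x Zx; have [//|k _ ek] := eP (x, j).
  have [_] := BP k; rewrite ek => /(_ Zx)[_ xB _].
  by apply: closureS xB; apply: bigcup_sup; rewrite /= ek.
- move=> i j _ _ [x [[k [<- Zk] Bkx] [l [<- Zl] Blx]]].
  have [kl|->//|lk] := swo_total wo k l.
  + by have [_ /(_ Zl)[_ _ disj]] := BP l; case: (setI0_notin (disj _ _) Bkx Blx); exists k.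
  + by have [_ /(_ Zk)[_ _ disj]] := BP k; case: (setI0_notin (disj _ _) Blx Bkx); exists l.
Qed.

End topology.

Lemma small_set0 K T : infinite_set [set: K] -> small K (@set0 T).
Proof. by move=> Kinf le0; apply: Kinf; exact: card_le_finite le0 (finite_set0 _). Qed.

Lemma small_set1 K T (x : T) : infinite_set [set: K] -> small K [set x].
Proof. by move=> Kinf le1; apply: Kinf; exact: card_le_finite le1 (finite_set1 _). Qed.

Lemma small_setU K T (A B : set T) : infinite_set [set: K] ->
  small K A -> small K B -> small K (A `|` B).
Proof.
move=> Kinf As Bs.
have [Cfin|Cinf] := pselect (finite_set (A `|` B)).
  by move=> leC; apply: Kinf; exact: card_le_finite leC Cfin.
have main (C D : set T) : infinite_set (C `|` D) -> C #<= D -> small K D ->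
    small K (C `|` D).
  move=> CDinf CD; apply: small_le; apply: card_setU_le => //.
  apply: contra_not CDinf => Dfin; rewrite finite_setU; split=> //.
  exact: card_le_finite CD Dfin.
have [AB|BA] := card_le_total A B; first exact: main.
by rewrite setUC; apply: main; rewrite // setUC.
Qed.

(** * Regular cardinals *)

Section regular_case.
Variables (X : topologicalType) (K : cardinal) (W : set X).
Hypothesis regK : regular_cardinal K.
Hypothesis discrK : forall A : set X, discrete_subset A -> small K A.
Hypothesis oW : open W.
Hypothesis W0 : W !=set0.
Hypothesis bigW : forall G : set X, open G -> G !=set0 -> G `<=` W -> [set: K] #<= G.

Let Kinf : infinite_set [set: K].
Proof. by apply/infiniteP; exact: regK.1. Qed.

Lemma left_separated_resolution (lt : K -> K -> Prop) (ltp : K * K -> K * K -> Prop)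
    (x : K * K -> X) :
  initial_order lt -> strict_well_order ltp -> (forall w, small K (seg ltp w)) ->
  (forall w, ~ closure (x @` seg ltp w) (x w)) ->
  exists Z (D : K -> set X), [/\ Z !=set0, Z `<=` range x & resolution Z D].
Proof.
move=> [wo lts] wop segp xleft.
have xinj : injective x.
  move=> v w xvw; have [vw|//|wv] := swo_total wop v w.
    by case: (xleft w); apply: subset_closure; exists v.
  by case: (xleft v); apply: subset_closure; exists w.
pose col (B : set X) k := [set l | B (x (k, l))].
pose I (B : set X) := small K [set k | ~ small K (col B k)].
have IS (A B : set X) : A `<=` B -> I B -> I A.
  move=> AB; apply: smallS => k; apply: contra_not; apply: smallS => l; exact: AB.
have Ibig (T : Type) (J : set T) (A : T -> set X) :
    small K J -> (forall j, J j -> I (A j)) -> I (\bigcup_(j in J) A j).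
  move=> Js AI; apply: smallS (small_bigcup_regular regK Js AI) => k nk.
  apply: contrapT => nU; apply: nk.
  have -> : col (\bigcup_(j in J) A j) k = \bigcup_(j in J) col (A j) k by [].
  apply: small_bigcup_regular => // j Jj; apply: contrapT => ns.
  by apply: nU; exists j.
have Icol (B : set X) : (forall k, small K (col B k)) -> I B.
  move=> cs; rewrite /I (_ : [set k | _] = set0); first exact: small_set0.
  by apply/seteqP; split=> // k; apply; exact: cs.
have Ismall (B : set X) : small K B -> I B.
  move=> Bs; apply: Icol => k; apply: small_le Bs.
  by apply: (@inj_on_card_le _ _ _ _ (fun l => x (k, l))) => // l m _ _ /xinj[].
have IU (A B : set X) : I A -> I B -> I (A `|` B).
  move=> IA IB; apply: smallS (small_setU Kinf IA IB) => k ns.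
  apply: contrapT => /not_orP[/contrapT sA /contrapT sB]; apply: ns.
  exact: (small_setU Kinf sA sB).
(* At such a point the final recursion could get stuck, since the sets already used may cover such
   an [A]. *)
pose bad y A := I A /\ forall B, B `<=` range x -> I B -> A `&` B = set0 -> ~ closure B y.
pose R := [set y | range x y /\ exists A, bad y A].
have IR : I R.
  apply: contrapT => nIR.
  have /choice[A AP] w : exists A, R (x w) -> bad (x w) A.
    have [[_ [A bA]]|nR] := pselect (R (x w)); first by exists A.
    by exists set0.
  (* Each new point of [R] comes later in [ltp], lies in a fresh column and avoids the sets [A v] of
     the earlier points. If this were impossible, all columns of [R] outside [N] and the earlier
     columns would be small, and [R] would belong to [I]. *)
  have [k S SR Sle|f fP] := @wf_choice K _ lt [set w | R (x w)] (fun _ S w =>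
    forall v, S v -> [/\ ltp v w, v.1 <> w.1 & ~ A v (x w)]) (swo_wf wo).
    have Ss := small_le Sle (lts k).
    pose N := \bigcup_(v in S) (A v `|` x @` (seg ltp v `|` [set v])).
    have IN : I N.
      apply: Ibig => // v Sv; apply: IU; first by have [] := AP v (SR v Sv).
      apply: Ismall; apply: small_le (card_image_le _ _) _.
      by apply: small_setU => //; exact: small_set1.
    apply: contrapT => nex; apply: nIR.
    apply: (smallS _ (small_setU Kinf IN (small_le (card_image_le fst S) Ss))).
    move=> i ni; apply: contrapT => /not_orP[/contrapT si nS]; apply: ni.
    apply: smallS si => l Rl; apply: contrapT => nN; apply: nex.
    exists (i, l) => // v Sv; split.
    - have [//|vE|lv] := swo_total wop v (i, l); case: nN; exists v => //; right.
      + by exists v; [right|rewrite vE].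
      + by exists (i, l) => //; left.
    - by move=> /= vi; apply: nS; exists v.
    - by move=> Av; apply: nN; exists v => //; left.
  have f1 j k : (f j).1 = (f k).1 -> j = k.
    move=> e; have [jk|//|kj] := swo_total wo j k.
    + by have [_ /(_ (f j))[]] := fP k; [exists j|].
    + by have [_ /(_ (f k))[|_ ne _]] := fP j; [exists k|case: ne].
  (* Earlier points do not accumulate by left-separation. Later points meet each column at most
     once, so they form a member of [I]; it misses [A (f k)], and badness applies. *)
  have [||dg leg] := @discrete_range X K lt (x \o f) wo.
  - move=> k; apply: contra_not (xleft (f k)); apply: closureS => _ [j jk <-].
    by exists (f j) => //; have [_ /(_ (f j))[]] := fP k; [exists j|].
  - move=> k; have [_ badk] := AP _ (fP k).1; apply: badk.
    + by move=> _ [j _ <-]; exists (f j).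
    + apply: Icol => i.
      have [[l0 [j0 _ /xinj f0]]|e] := pselect (col ((x \o f) @` [set j | lt k j]) i !=set0).
        apply: (smallS _ (@small_set1 K K l0 Kinf)) => l [j _ /xinj fj].
        have j0j : j0 = j by apply: f1; rewrite f0 fj.
        by move: fj; rewrite -j0j f0 => -[].
      apply: (smallS _ (@small_set0 K K Kinf)) => l cl; apply: e; by exists l.
    + apply/seteqP; split=> // y [Ay [j kj yE]].
      have [_ /(_ (f k))[|_ _]] := fP j; first by exists k.
      by apply; rewrite -/((x \o f) j) yE.
  exact: (discrK dg leg).
exists (range x `\` R).
have [D DP] : exists D : K -> set X, resolution (range x `\` R) D.
  apply: (@resolution_by_accumulation X K lt _ I) => //.
    apply: card_le_trans (infinite_square Kinf).
    apply: card_le_trans (card_image_le x setT); apply: subset_card_le.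
    exact: subDsetl.
  move=> F FI Fs y [xy nRy].
  (* The sets already used, together with [R], form a member of [I]. As [y] is outside [R], this
     member is not bad for [y], so some [B] in [I] misses it and accumulates at [y]. *)
  have IA : I ((\bigcup_(A in F) A) `|` R) by apply: IU => //; apply: Ibig.
  apply: contrapT => nB; apply: nRy; split=> //; exists ((\bigcup_(A in F) A) `|` R).
  split=> // B Bx IB AB By; apply: nB; exists B; split=> //.
    by move=> z Bz; split; [exact: Bx|move=> Rz; apply: (setI0_notin AB _ Bz); right].
  move=> A FA; apply/seteqP; split=> // z [Az Bz].
  by apply: (setI0_notin AB _ Bz); left; exists A.
exists D; split=> //.
(* Otherwise [range x] would lie in [R], hence in [I], although all of its columns are full. *)
apply: contrapT => e.
have IX : I (range x).
  by apply: IS IR => y xy; apply: contrapT => nRy; apply: e; exists y; split.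
apply: IX; apply: subset_card_le => k _; apply; apply: subset_card_le => l _.
by exists (k, l).
Qed.

Lemma regular_resolution :
  exists Z (D : K -> set X), [/\ Z !=set0, Z `<=` W & resolution Z D].
Proof.
have [lt [wo lts]] := initial_order_exists K.
have [ex|] := pselect (forall M, M `<=` W -> small K M -> exists S,
    [/\ small K S, S `<=` W, W `<=` closure S & M `&` S = set0]).
  exists W; have [F FQ Fs|D DP] :=
    @resolution_by_dense_sets X K lt W [set B | small K B /\ B `<=` W] (conj wo lts).
    have [||S [Ss SW WS dS]] := ex (\bigcup_(B in F) B).
    - by move=> y [B /FQ[_ BW] By]; exact: BW.
    - by apply: small_bigcup_regular => // B /FQ[].
    exists S; split=> // A FA; apply/seteqP; split=> // y [Ay Sy].
    by apply: (setI0_notin dS _ Sy); exists A.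
  by exists D; split.
move=> /existsNP[M /not_implyP[MW /not_implyP[Ms nS]]].
have [k0 _] := infinite_setN0 Kinf.
(* Ordering [K * K] through an injection into [K] keeps its segments small. *)
have [p [_ pinj]] := card_le_inj_on (infinite_square Kinf) (ex_intro _ (k0, k0) I).
have wop : strict_well_order (fun v w => lt (p v) (p w)).
  by apply: swo_preimage => // v w; exact: pinj.
set ltp := fun v w => _ in wop.
have segp w : small K (seg ltp w).
  apply: small_le (lts (p w)).
  by apply: (@inj_on_card_le _ _ _ _ p) => // u v _ _; exact: pinj.
(* A small [S] off [M] is not dense in [W], by the choice of [M]. The part of [W] off its closure
   has size at least [K], so it is not contained in [M]. *)
have [w S SWM Sle|x xP] :=
    @wf_choice (K * K) X ltp (W `\` M) (fun _ S t => ~ closure S t) (swo_wf wop).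
  have Ss := small_le Sle (segp w).
  have [y Wy ny] : exists2 y, W y & ~ closure S y.
    apply: contrapT => nex; apply: nS; exists S; split=> //.
    - by move=> y /SWM[].
    - by move=> y Wy; apply: contrapT => ny; apply: nex; exists y.
    - by apply/seteqP; split=> // y [My /SWM[]].
  apply: contrapT => nex; apply: Ms.
  apply: (@card_le_trans _ _ _ (W `&` ~` closure S)).
    apply: bigW; first by apply: openI => //; exact: open_closureC.
      by exists y.
    exact: subIsetl.
  apply: subset_card_le => t [Wt nt]; apply: contrapT => nMt.
  by apply: nex; exists t.
have [|Z [D [Z0 Zx DP]]] := @left_separated_resolution lt ltp x (conj wo lts) wop segp.
  by move=> w; have [_] := xP w.
exists Z, D; split=> // y /Zx[w _ <-].
by have [[]] := xP w.
Qed.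
End regular_case.

(** The common bound [C] takes the place of regularity: the union is at most the larger of [C] and
    [J]. *)
Lemma small_bigcup_le K L T V (J : set L) (A : L -> set T) (C : set V) :
  infinite_set C -> small K C -> small K J -> (forall j, J j -> A j #<= C) ->
  small K (\bigcup_(j in J) A j).
Proof.
move=> Cinf Cs Js AC; have [CJ|JC] := card_le_total C J.
  apply: small_le Js; apply: card_bigcup_le => // [|j Jj].
    exact: infinite_card_le CJ Cinf.
  exact: card_le_trans (AC j Jj) CJ.
by apply: small_le Cs; exact: card_bigcup_le.
Qed.

(** * Points accumulated by small sets *)

Section tightness.
Variables (X : topologicalType) (R : cardinal).
Hypothesis regR : regular_cardinal R.
Hypothesis discrR : forall A : set X, discrete_subset A -> small R A.
Implicit Types (J : Type) (A B F G Q W Y Z : set X).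

Let Rinf : infinite_set [set: R].
Proof. by apply/infiniteP; exact: regR.1. Qed.

Definition tight J F := forall x A, F x -> A #<= [set: J] -> exists B,
  [/\ B `<=` F, A `&` B = set0, B #<= [set: R] & closure B x].

(** Unions of tight sets are tight, so this is the largest tight subset of [W]. *)
Definition tight_kernel J W := \bigcup_(F in [set F | F `<=` W /\ tight J F]) F.

Lemma tight_kernelP J W : tight J (tight_kernel J W).
Proof.
move=> x A [F [FW Ft] Fx] AJ; have [B [BF AB BR Bx]] := Ft x A Fx AJ.
by exists B; split=> // y /BF Fy; exists F.
Qed.

Lemma tight_kernel_sub J W : tight_kernel J W `<=` W.
Proof. by move=> x [F [FW _] /FW]. Qed.

Lemma tight_kernelS J J' W : [set: J'] #<= [set: J] ->
  tight_kernel J W `<=` tight_kernel J' W.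
Proof.
move=> J'J x [F [FW Ft] Fx]; exists F => //; split=> // y A Fy AJ'.
exact: Ft Fy (card_le_trans AJ' J'J).
Qed.

(* The points [p.1] chosen below are later left behind together with the small
   sets [p.2] witnessing that they are not accumulated, so they would form a
   discrete sequence of length [R]; the choice must stop, and then the points and
   sets chosen so far provide the dense subset. *)
Lemma kernelC_density J W Y : infinite_set [set: J] -> [set: R] #<= [set: J] ->
  Y `<=` W `\` tight_kernel J W ->
  exists E, [/\ E `<=` Y, E #<= [set: J] & Y `<=` closure E].
Proof.
move=> Jinf RJ YW; apply: contrapT => nE.
have [lt [wo lts]] := initial_order_exists R.
pose H (S : set (X * set X)) := Y `\` (closure (fst @` S) `|` \bigcup_(q in S) q.2).
have HS (S S' : set (X * set X)) : S `<=` S' -> H S' `<=` H S.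
  move=> SS' x [Yx nx]; split=> // -[xS|[q Sq qx]]; apply: nx.
    by left; apply: closureS xS; exact: image_subset.
  by right; exists q => //; exact: SS'.
have [r S SQ Sle|f fP] := @wf_choice R _ lt [set p | p.2 #<= [set: J] /\ Y p.1]
   (fun _ S p => H S p.1 /\ forall B, B `<=` H S -> p.2 `&` B = set0 ->
       B #<= [set: R] -> ~ closure B p.1) (swo_wf wo).
  have SJ : S #<= [set: J].
    by apply: card_le_trans Sle (card_le_trans (card_leT _) RJ).
  have [y Hy] : H S !=set0.
    apply: contrapT => H0; apply: nE.
    exists (fst @` S `|` (Y `&` \bigcup_(q in S) q.2)); split.
    - by move=> y [[q /SQ[_ Yq] <-]|[]].
    - apply: card_setU_le => //; first exact: card_le_trans (card_image_le _ _) SJ.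
      apply: card_le_trans (subset_card_le (@subIsetr _ _ _)) _.
      by apply: card_bigcup_le => // q /SQ[].
    - move=> y Yy; apply: contrapT => ny; apply: H0; exists y; split=> // -[yS|yU]; apply: ny.
        by apply: closureS yS => z zS; left.
      by apply: subset_closure; right.
  (* The kernel enlarged by [H S] contains a point outside the kernel, so it is not tight. The
     failure occurs at a point of [H S], because the kernel itself is tight. *)
  have [x [A [Fx AJ nB]]] : exists x A, [/\ (tight_kernel J W `|` H S) x, A #<= [set: J] &
      ~ exists B, [/\ B `<=` tight_kernel J W `|` H S, A `&` B = set0,
                     B #<= [set: R] & closure B x]].
    apply: contrapT => nx; have [Yy _] := Hy; have [_] := YW y Yy; apply.
    exists (tight_kernel J W `|` H S); last by right.
    split; first by move=> z [/tight_kernel_sub//|[/YW[]]].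
    by move=> z A Fz AJ; apply: contrapT => nB; apply: nx; exists z, A.
  case: Fx => [Fx|Hx].
    have [B [BF AB BR Bx]] := tight_kernelP Fx AJ.
    by case: nB; exists B; split=> // z /BF; left.
  exists (x, A); first by split=> //; case: Hx.
  split=> // B BH AB BR Bx; apply: nB; exists B; split=> // z /BH; by right.
have [||dg leg] := @discrete_range X R lt (fst \o f) wo; last exact: (discrR dg leg).
- move=> r; have [_ [[_ nr] _]] := fP r; apply: contra_not nr; rewrite image_comp; by left.
- move=> r; have [_ [_ nB]] := fP r; apply: nB.
  + move=> _ [j rj <-] /=; have [_ [Hj _]] := fP j.
    apply: HS Hj => _ [i ir <-]; exists i => //; exact: (swo_trans wo ir rj).
  + apply/seteqP; split=> // y [ry [j rj yE]].
    have [_ [[_ nj] _]] := fP j; apply: nj; right; exists (f r); first by exists r.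
    by rewrite -/((fst \o f) j) yE.
  + by apply: card_le_trans (card_image_le _ _) (card_leT _).
Qed.

(** Off the kernel, what remains of [G] after removing the pieces already chosen has a dense subset
    of size at most [J], which serves as the next piece. *)
Lemma thin_resolution L J W G : infinite_set [set: J] -> [set: R] #<= [set: J] ->
  small L [set: J] -> G `<=` W -> G `&` tight_kernel J W = set0 ->
  (forall V, open V -> (V `&` G) !=set0 -> [set: L] #<= V `&` G) ->
  exists D : L -> set X, resolution G D.
Proof.
move=> Jinf RJ Js GW Gk Gbig.
have [lt lti] := initial_order_exists L.
apply: (@resolution_by_dense_sets X L lt G [set B | B #<= [set: J]] lti) => F FQ Fs.
have Ms : small L (\bigcup_(B in F) B) by exact: small_bigcup_le Jinf Js Fs FQ.
have [|E [EY EJ YE]] := @kernelC_density J W (G `\` \bigcup_(B in F) B) Jinf RJ.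
  by move=> x [Gx _]; split; [exact: GW|move=> kx; exact: (setI0_notin Gk Gx kx)].
exists E; split=> //; first by move=> x /EY[].
  (* Fewer than [L] points were removed, while every nonempty open part of [G] has at least [L]; so
     the rest is dense in [G]. *)
  apply: subset_trans (closure_sub YE) => x Gx V.
  rewrite nbhsE => -[V' [oV' V'x] V'V].
  apply: contrapT => nV; apply: Ms; apply: card_le_trans (Gbig V' oV' _) _; first by exists x.
  apply: subset_card_le => y [V'y Gy]; apply: contrapT => ny; apply: nV.
  by exists y; split; [split|exact: V'V].
move=> A FA; apply/seteqP; split=> // x [Ax /EY[_]]; apply; by exists A.
Qed.

(** The disjoint witnesses at [z] are fixed in advance, whereas tightness supplies one for each set
    [A] to be avoided. Hence a subset closed under chosen witnesses is again ample. *)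
Definition ample J Z := forall z, Z z -> exists b : J -> set X,
  [/\ forall j, b j `<=` Z, forall j, b j #<= [set: R],
      forall j, closure (b j) z & trivIset setT b].

Lemma tight_family J F A x : infinite_set [set: J] -> [set: R] #<= [set: J] ->
  tight J F -> A #<= [set: J] -> F x -> exists b : J -> set X,
  [/\ forall j, b j `<=` F `\` A, forall j, b j #<= [set: R],
      forall j, closure (b j) x & trivIset setT b].
Proof.
move=> Jinf RJ Ft AJ Fx; have [lt wo] := strict_well_order_exists J.
have [j S SQ Sle|b bP] := @wf_choice J _ lt [set B | B #<= [set: R]]
    (fun _ S B => [/\ B `<=` F `\` A, closure B x & forall C, S C -> C `&` B = set0]) (swo_wf wo).
  have UJ : A `|` \bigcup_(B in S) B #<= [set: J].
    apply: card_setU_le => //; apply: card_bigcup_le => //.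
      by apply: card_le_trans Sle (card_leT _).
    by move=> B /SQ /card_le_trans; apply.
  have [B [BF AB BR Bx]] := Ft x _ Fx UJ.
  exists B => //; split=> //.
    by move=> y By; split; [exact: BF|move=> Ay; apply: (setI0_notin AB _ By); left].
  move=> C SC; apply/seteqP; split=> // y [Cy By].
  by apply: (setI0_notin AB _ By); right; exists C.
exists b; split=> [j|j|j|i j _ _ [y [bi bj]]].
- by have [_ []] := bP j.
- by have [] := bP j.
- by have [_ []] := bP j.
- have [ij|//|ji] := swo_total wo i j.
  + by have [_ [_ _ disj]] := bP j; case: (setI0_notin (disj _ _) bi bj); exists i.
  + by have [_ [_ _ disj]] := bP i; case: (setI0_notin (disj _ _) bj bi); exists j.
Qed.

(** [Q] is closed off in countably many steps under a fixed choice of witnesses. *)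
Lemma ample_closing J V (C : set V) F Q : ample J F -> infinite_set C ->
  [set: R] #<= C -> [set: J] #<= C -> Q `<=` F -> Q #<= C ->
  exists Y, [/\ Q `<=` Y, Y `<=` F, Y #<= C & ample J Y].
Proof.
move=> Fa Cinf RC JC QF QC.
have /choice[b bP] z : exists b : J -> set X, F z ->
  [/\ forall j, b j `<=` F, forall j, b j #<= [set: R],
      forall j, closure (b j) z & trivIset setT b].
  have [/Fa[b bP]|nF] := pselect (F z); first by exists b.
  by exists (fun=> set0).
pose step Z := Z `|` \bigcup_(z in Z) \bigcup_j b z j.
pose Yn n := iter n step Q.
have YnF n : Yn n `<=` F.
  elim: n => //= n IH x [/IH//|[z /IH Fz [j _ bzj]]].
  by have [bF _ _ _] := bP z Fz; exact: bF bzj.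
have YnC n : Yn n #<= C.
  elim: n => //= n IH; apply: card_setU_le => //.
  apply: card_bigcup_le => // z /YnF Fz; apply: card_bigcup_le => // j _.
  by have [_ bR _ _] := bP z Fz; apply: card_le_trans (bR j) RC.
exists (\bigcup_n Yn n); split.
- by move=> x Qx; exists 0.
- by move=> x [n _ /YnF].
- by apply: card_bigcup_le => //; apply/infiniteP.
- move=> z [n _ Yz]; have [bF bR bz btriv] := bP z (YnF n z Yz).
  exists (b z); split=> // j x bx; exists n.+1 => //=; right; exists z => //.
  by exists j.
Qed.

(** Fewer than [J] sets of size at most [R] have a union smaller than [J], so one of the [J]
    disjoint witnesses at a point misses it. *)
Lemma ample_resolution_le J Z : infinite_set [set: J] -> small J [set: R] ->
  Z #<= [set: J] -> ample J Z -> exists D : J -> set X, resolution Z D.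
Proof.
move=> Jinf Rs ZJ Za; have [lt lti] := initial_order_exists J.
apply: (@resolution_by_accumulation X J lt Z [set B | B #<= [set: R]] lti) => // F FQ Fs x Zx.
have Us : small J (\bigcup_(B in F) B) by exact: small_bigcup_le Rinf Rs Fs FQ.
have [b [bZ bR bx btriv]] := Za x Zx.
have [j bj] : exists j, (\bigcup_(B in F) B) `&` b j = set0.
  apply: contrapT => nj; apply: Us.
  have /choice[g gP] j : exists y, (\bigcup_(B in F) B) y /\ b j y.
    apply: contrapT => ny; apply: nj; exists j; apply/seteqP; split=> // y [Uy by_].
    by apply: ny; exists y.
  apply: (@inj_on_card_le _ _ _ _ g) => [j _|i j _ _ gij]; first by have [] := gP j.
  apply: btriv => //; exists (g i); split; first by have [] := gP i.
  by rewrite gij; have [] := gP j.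
exists (b j); split; [exact: bR|exact: bZ|exact: bx|move=> A FA].
apply/seteqP; split=> // y [Ay bjy].
by apply: (setI0_notin bj _ bjy); exists A.
Qed.

(** Ampleness passes to relatively open parts, and closing off one point there gives a subset of
    size at most [J]; local resolutions suffice. *)
Lemma ample_resolution J Y : infinite_set [set: J] -> small J [set: R] ->
  ample J Y -> exists D : J -> set X, resolution Y D.
Proof.
move=> Jinf Rs Ya; apply: resolution_local => W y oW Wy Yy.
have WYa : ample J (W `&` Y).
  move=> z [Wz /Ya[b [bY bR bz btriv]]]; exists (fun j => W `&` b j); split.
  - by move=> j x [Wx /bY].
  - by move=> j; apply: (card_le_trans _ (bR j)); apply: subset_card_le => x [].
  - move=> j V Vz; have [x [bx [Wx Vx]]] :=
      bz j (W `&` V) (filterI (open_nbhs_nbhs (conj oW Wz)) Vz).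
    by exists x.
  - by move=> i j _ _ [x [[_ bi] [_ bj]]]; apply: btriv => //; exists x.
have [||Z [yZ ZWY ZJ Za]] :=
  ample_closing WYa Jinf (small_card_leW Rs) (card_lexx _) (_ : [set y] `<=` _) _.
- by move=> _ ->.
- by apply: small_card_leW; exact: small_set1.
have [D DP] := ample_resolution_le Jinf Rs ZJ Za.
by exists Z, D; split=> //; exists y; exact: yZ.
Qed.

Lemma tight_level J V (C : set V) F A Q : infinite_set [set: J] -> small J [set: R] ->
  [set: J] #<= C -> tight J F -> A #<= [set: J] -> Q `<=` F -> Q #<= C ->
  exists Y, [/\ Y `<=` F `\` A, Y #<= C, Q `<=` closure Y &
    exists D : J -> set X, resolution Y D].
Proof.
move=> Jinf Rs JC Ft AJ QF QC; have RJ := small_card_leW Rs.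
have Cinf := infinite_card_le JC Jinf; have RC := card_le_trans RJ JC.
have Fa : ample J (F `\` A) by move=> z [Fz _]; exact: tight_family.
have [j0 _] := infinite_setN0 Jinf.
(* [Q] may meet [A], so each [q] is represented by a set of size at most [R] in [F] off [A] that
   accumulates at it. *)
have /choice[B BP] q : exists B, Q q -> [/\ B `<=` F `\` A, B #<= [set: R] & closure B q].
  have [Qq|nQ] := pselect (Q q); last by exists set0.
  have [b [bF bR bq _]] := tight_family Jinf RJ Ft AJ (QF q Qq).
  by exists (b j0).
have [||Y [QY YF YC Ya]] := ample_closing Fa Cinf RC JC (_ : \bigcup_(q in Q) B q `<=` _) _.
- by move=> x [q Qq]; have [BF _ _] := BP q Qq; exact: BF.
- by apply: card_bigcup_le => // q Qq; have [_ /card_le_trans + _] := BP q Qq; apply.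
exists Y; split=> //; last exact: ample_resolution.
move=> q Qq; have [_ _] := BP q Qq; apply: closureS => x Bx; apply: QY.
by exists q.
Qed.

End tightness.

(** * Singular cardinals *)

(** [L] is covered by fewer than [L] sets, each no larger than some [seg lt (t i)]. If the [t i]
    were bounded, these sizes would have a common bound below [L], made infinite by [seg lt r], and
    the union would be too small. *)
Lemma singular_cofinal L (lt : L -> L -> Prop) r : initial_order lt ->
  infinite_set (seg lt r) -> ~ regular_cardinal L ->
  exists C : set L, small L C /\ forall l, exists2 c, C c & lt l c.
Proof.
move=> [wo lts] rinf nreg.
have Linf : infinite_set [set: L] by exact: infinite_card_le (card_leT _) rinf.
have : ~ forall (I : cardinal) (A : I -> set L), clt I L ->
    (forall i, clt (card_of (A i)) L) -> \bigcup_i A i <> [set: L].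
  by move=> h; apply: nreg; split=> //; apply/infiniteP.
move=> /existsNP[I /existsNP[A /not_implyP[[_ IL] /not_implyP[AL /contrapT UA]]]].
have /choice[t tA] i : exists t, A i #<= seg lt t.
  apply: card_lt_seg => //; have [_] := AL i.
  by rewrite /cle card_set_type_r.
exists (range t); split; first exact: small_le (card_image_le _ _) IL.
move=> l; apply: contrapT => nl.
suff : small L (\bigcup_i A i) by apply; rewrite UA card_lexx.
apply: (@small_bigcup_le _ _ _ _ _ _ (seg lt l `|` [set l] `|` seg lt r)) => //.
- by apply: contra_not rinf; rewrite finite_setU => -[].
- apply: (small_setU Linf); last exact: lts.
  by apply: (small_setU Linf); [exact: lts|exact: small_set1].
- move=> i _; apply: card_le_trans (tA i) (subset_card_le _) => k kt; left.
  have [lt_lt|->|tl] := swo_total wo l (t i); last by left; exact: (swo_trans wo kt tl).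
  + by case: nl; exists (t i).
  + by left.
Qed.

Section singular_case.
Variables (X : topologicalType) (R : cardinal) (L : cardinal) (W : set X).
Hypothesis regR : regular_cardinal R.
Hypothesis discrR : forall A : set X, discrete_subset A -> small R A.
Hypothesis oW : open W.
Hypothesis W0 : W !=set0.
Hypothesis WL : W #<= [set: L].
Hypothesis bigW : forall G : set X, open G -> G !=set0 -> G `<=` W -> [set: L] #<= G.
Hypothesis singL : ~ regular_cardinal L.
Hypothesis RL : small L [set: R].

Let Rinf : infinite_set [set: R].
Proof. by apply/infiniteP; exact: regR.1. Qed.

Let Linf : infinite_set [set: L].
Proof. exact: infinite_card_le (small_card_leW RL) Rinf. Qed.

Lemma singular_resolution :
  exists Z (D : L -> set X), [/\ Z !=set0, Z `<=` W & resolution Z D].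
Proof.
have [lt lti] := initial_order_exists L; have [wo lts] := lti.
have segS i j : lt i j -> seg lt i `<=` seg lt j by move=> ij k ki; exact: (swo_trans wo ki ij).
have [r Rr] := card_lt_seg wo RL.
have rinf : infinite_set (seg lt r) := infinite_card_le Rr Rinf.
have [C [Cs Ccof]] := singular_cofinal lti rinf singL.
have [t Ct] := card_lt_seg wo Cs.
have up i j : exists2 c, C c & lt i c /\ lt j c.
  have [c Cc ic] := Ccof i; have [d Cd jd] := Ccof j.
  have [cd|cd|dc] := swo_total wo c d.
  - by exists d => //; split=> //; exact: (swo_trans wo ic cd).
  - by exists d => //; split=> //; rewrite -cd.
  - by exists c => //; split=> //; exact: (swo_trans wo jd dc).
have [b [Cb binf Rb]] : exists b, [/\ C #<= seg lt b, infinite_set (seg lt b) &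
    small (seg lt b) [set: R]].
  (* Otherwise the segments given by [C], fewer than [L] and each of size at most [R], would cover
     [L]. *)
  have [s0 Rs0] : exists s0, small (seg lt s0) [set: R].
    apply: contrapT => ns; suff : small L (\bigcup_(c in C) seg lt c).
      apply; apply: subset_card_le => l _; have [d Cd ld] := Ccof l.
      by exists d.
    apply: (small_bigcup_le Rinf RL Cs) => d _; apply: contrapT => nd.
    by apply: ns; exists d; rewrite /small card_set_type.
  have [d1 _ [rd1 td1]] := up r t; have [b _ [d1b s0b]] := up d1 s0.
  have rb := swo_trans wo rd1 d1b; have tb := swo_trans wo td1 d1b.
  exists b; split.
  - exact: card_le_trans Ct (subset_card_le (segS _ _ tb)).
  - exact: infinite_card_le (subset_card_le (segS _ _ rb)) rinf.
  - move: Rs0; rewrite /small !card_set_type; apply: contra_not.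
    exact: (card_le_trans (subset_card_le (segS _ _ s0b))).
(* [s i] bounds the size of the level [i]; for [i] in [C] it lies in every later [c j], so later
   levels can avoid this one. *)
pose s i := seg lt i `|` seg lt b.
(* [c i] plays the role of the cardinal [k_i]; it is continuous at limits of [C]. *)
pose c i := seg lt b `|` \bigcup_(j in [set j | C j /\ lt j i]) seg lt j.
have cinf i : infinite_set [set: set_type (c i)].
  rewrite (eq_finite_set (card_setT _)); apply: infinite_card_le binf.
  by apply: subset_card_le => k; left.
have bc i : seg lt b `<=` c i by move=> k; left.
have Rc i : small (set_type (c i)) [set: R].
  move: Rb; rewrite /small !card_set_type; apply: contra_not.
  exact: (card_le_trans (subset_card_le (bc i))).
have Rcle i : [set: R] #<= [set: set_type (c i)] by exact: small_card_leW.
have cs i : c i `<=` s i.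
  by move=> k [kb|[j [_ ji] kj]]; [right|left; exact: segS kj].
have cS i j : lt i j -> c i `<=` c j.
  move=> ij k [kb|[h [Ch hi] kh]]; first by left.
  by right; exists h => //; split=> //; exact: (swo_trans wo hi ij).
have sc i j : C i -> lt i j -> s i `<=` c j.
  by move=> Ci ij k [ki|kb]; [right; exists i|left].
have sinf i : infinite_set (s i).
  by apply: infinite_card_le binf; apply: subset_card_le => k; right.
have ssmall i : small L (s i) by apply: (small_setU Linf); exact: lts.
pose F i := @tight_kernel X R (set_type (c i)) W.
have Ft i : tight R (set_type (c i)) (F i) by exact: tight_kernelP.
have FW i : F i `<=` W by exact: tight_kernel_sub.
have FS i j : lt i j -> F j `<=` F i.
  move=> ij; apply: tight_kernelS; rewrite card_set_type card_set_type_r.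
  by apply: subset_card_le; exact: cS.
have [[i [y Wy ny]]|Fdense] := pselect (exists i, exists2 y, W y & ~ closure (F i) y).
  pose G := W `&` ~` closure (F i).
  have GW : G `<=` W by move=> x [].
  have G0 : G !=set0 by exists y.
  have oG : open G by apply: openI => //; exact: open_closureC.
  have [|||D DP] := @thin_resolution X R discrR L _ W G (cinf i) (Rcle i) _ GW.
  - by rewrite /small card_set_type_r; apply: smallS (cs i) (ssmall i).
  - apply/seteqP; split=> // x [[_ nx] Fx]; apply: nx; exact: subset_closure.
  - move=> V oV VG; apply: bigW => //; first exact: openI.
    by move=> x [_ /GW].
  by exists G, D.
have {}Fdense i : W `<=` closure (F i).
  by move=> x Wx; apply: contrapT => nx; apply: Fdense; exists i, x.
(* The points that leave the decreasing sets [F i] exactly at [l].  A dense subset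
   of them, of size at most [c l], is spread over the earlier levels, where they
   still belong to [F i]. *)
pose exitset l := [set x | [/\ W x, ~ F l x & forall j, C j -> lt j l -> F j x]].
have /choice[E EP] l : exists E, [/\ E `<=` exitset l, E #<= c l & exitset l `<=` closure E].
  have [|E [EG Ec GE]] :=
    @kernelC_density X R discrR _ W (exitset l) (cinf l) (Rcle l).
    by move=> x [Wx nFx _].
  by exists E; split=> //; rewrite -(card_set_type_r (c l)).
have /choice[e eP] l : exists e : X -> L, (forall x, E l x -> c l (e x)) /\
    (forall x y, E l x -> E l y -> e x = e y -> x = y).
  have [E0|E0] := pselect (E l !=set0).
    by have [_ Ec _] := EP l; exact: card_le_inj_on Ec E0.
  by exists (fun=> r); split=> [x Ex|x y Ex]; case: E0; exists x.
have [idx [_ idxinj]] := card_le_inj_on WL W0.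
(* These points must lie in the closure of the level [i]: the points of [F i] with index below [i],
   and the points of later sets [E l] whose code lies in [s i]. *)
pose Q i := [set x | F i x /\ seg lt i (idx x)] `|`
  \bigcup_(l in [set l | C l /\ lt i l]) [set x | E l x /\ s i (e l x)].
have QF i : C i -> Q i `<=` F i.
  move=> Ci x [[]//|[l [Cl il] [Ex _]]]; have [EG _ _] := EP l.
  by have [_ _] := EG x Ex; apply.
have Cle_s i : C #<= s i.
  apply: card_le_trans Cb (subset_card_le _) => k kb; by right.
have Qs i : Q i #<= s i.
  apply: card_setU_le => //.
    apply: (@inj_on_card_le _ _ _ _ idx) => [x [_ ?]|x y [Fx _] [Fy _]]; first by left.
    by apply: idxinj; [exact: FW Fx|exact: FW Fy].
  apply: card_bigcup_le => //.
    by apply: card_le_trans (Cle_s i); apply: subset_card_le => l [].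
  move=> l _; apply: (@inj_on_card_le _ _ _ _ (e l)) => [x []//|x y [Ex _] [Ey _]].
  exact: (eP l).2.
(* Pieces are indexed by all of [L], with conditions only for indices in [c i], so that equal
   indices can be united across levels. *)
pose good i A Y := [/\ Y `<=` F i `\` A, Q i `<=` closure Y &
  exists D : L -> set X, (forall k, c i k -> D k `<=` Y /\ Y `<=` closure (D k)) /\
    trivIset (c i) D].
have level i A : C i -> A #<= c i -> exists Y, Y #<= s i /\ good i A Y.
  move=> Ci Ac.
  have [||Y [YF Ys QY [D [DY YD Dtriv]]]] :=
    @tight_level X R regR _ _ (s i) (F i) A (Q i) (cinf i) (Rc i) _ (Ft i) _ (QF i Ci) (Qs i).
  - by rewrite card_set_type; apply: subset_card_le; exact: cs.
  - by rewrite card_set_type_r.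
  exists Y; split=> //; split=> //.
  exists (fun k => if pselect (c i k) is left h then D (SigSub (mem_set h)) else set0).
  split=> [k ck|k k' ck ck'].
    by case: pselect.
  case: pselect => // h; case: pselect => // h' DD.
  by have [] := Dtriv _ _ I I DD.
pose K := set_type C.
have woC : strict_well_order (fun i j : K => lt (val i) (val j)).
  by apply: swo_preimage => //; exact: val_inj.
have CK (i : K) : C (val i) by exact: set_valP.
(* Values are tagged with their index since [wf_choice] only shows the range of
   the earlier ones. *)
have [i S SQ Sle|Y YP] := @wf_choice K (K * set X) _ [set p | p.2 #<= s (val p.1)]
    (fun i S p => p.1 = i /\ ((forall q, S q -> lt (val q.1) (val i)) ->
       good (val i) (\bigcup_(q in S) q.2) p.2)) (swo_wf woC).
  have [Si|nSi] := pselect (forall q, S q -> lt (val q.1) (val i)); last first.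
    by exists (i, set0); [exact: card_ge0|split].
  have [|Y [Ys gY]] := level (val i) (\bigcup_(q in S) q.2) (CK i).
    apply: card_bigcup_le.
    - by have := cinf (val i); rewrite (eq_finite_set (card_setT _)).
    - apply: card_le_trans Sle (card_le_trans (card_leT _) _).
      rewrite card_set_type; apply: card_le_trans Cb (subset_card_le _).
      exact: bc.
    - move=> q Sq; apply: card_le_trans (SQ q Sq) (subset_card_le _).
      by apply: sc; [exact: CK|exact: Si].
  by exists (i, Y).
have {}YP (i : K) : (forall j : K, lt (val j) (val i) -> (Y j).2 `&` (Y i).2 = set0) /\
    good (val i) set0 (Y i).2.
  have Y1 j : (Y j).1 = j by have [_ []] := YP j.
  have [_ [_ gd]] := YP i.
  have [|YF QY DP] := gd; first by move=> _ [j ji <-]; rewrite Y1.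
  split; last by split=> // x /YF[Fx _]; split.
  move=> j ji; apply/seteqP; split=> // x [Yj /YF[_]]; apply.
  by exists (Y j) => //; exists j.
have /choice[D DP] (i : K) : exists D : L -> set X,
    (forall k, c (val i) k -> D k `<=` (Y i).2 /\ (Y i).2 `<=` closure (D k)) /\
    trivIset (c (val i)) D.
  by have [_ [_ _]] := YP i.
pose D' k := \bigcup_(i in [set i : K | c (val i) k]) D i k.
have QD i k : C i -> c i k -> Q i `<=` closure (D' k).
  move=> Ci cik; pose i' : K := SigSub (mem_set Ci).
  have [_ [_ QY _]] := YP i'; apply: subset_trans QY (closure_sub _).
  have [/(_ k cik)[_ YD] _] := DP i'; apply: subset_trans YD (closureS _).
  by move=> x Dx; exists i'.
exists W, D'; split=> //; split.
- move=> k x [i cik Dx]; have [_ [YF _ _]] := YP i.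
  have [/(_ k cik)[DY _] _] := DP i.
  by have [Fx _] := YF x (DY x Dx); exact: FW Fx.
(* From [i0] on every [c i] contains [k]. As [F i0] is dense in [W], its points need only be reached
   through the sets [Q i] with [i] at or after [i0]. *)
- move=> k; have [i1 Ci1 [ki1 _]] := up k k; have [i0 Ci0 [i10 _]] := up i1 i1.
  have ci0 : c i0 k by right; exists i1.
  apply: subset_trans (Fdense i0) (closure_sub _) => x Fx.
  have cge i : lt i0 i \/ i0 = i -> c i k by move=> [/cS|<-//]; apply.
  have [Fall|/existsNP[l0 /not_implyP[Cl0 nFl0]]] := pselect (forall i, C i -> F i x).
    have [i Ci [i0i xi]] := up i0 (idx x).
    apply: (QD i k Ci); first by apply: cge; left.
    by left; split; [exact: Fall|].
  have [l [Cl nFl] lmin] :=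
    wf_min (swo_wf wo) (ex_intro [set l | C l /\ ~ F l x] l0 (conj Cl0 nFl0)).
  have i0l : lt i0 l.
    by have [//|i0E|/FS li0] := swo_total wo i0 l; case: nFl; [rewrite -i0E|exact: li0].
  have [EG Ec GE] := EP l.
  have xE : closure (E l) x.
    apply: GE; split=> // [|j Cj jl]; first exact: FW Fx.
    by apply: contrapT => nFj; apply: (lmin j jl).
  apply: closure_sub xE => y Ey.
  (* Continuity of [c] is used here: the code of [y] lies in [seg lt b] or below some [j] of [C]
     before [l], so [y] is prescribed at a level before [l]. *)
  have [i [Ci il i0i si]] : exists i, [/\ C i, lt i l, lt i0 i \/ i0 = i & s i (e l y)].
    case: ((eP l).1 y Ey) => [eb|[j [Cj jl] ej]].
      by exists i0; split=> //; [right|right].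
    have [i0j|i0j|ji0] := swo_total wo i0 j.
    - by exists j; split=> //; left.
    - by exists j; split=> //; [right|left].
    - by exists i0; split=> //; [right|left; exact: segS ji0 _ ej].
  apply: (QD i k Ci (cge i i0i)); right; exists l => //.
- move=> k k' _ _ [x [[i cik Dik] [j cjk' Djk']]].
  have DY (h : K) m : c (val h) m -> D h m x -> (Y h).2 x.
    by move=> chm Dhm; have [/(_ m chm)[DhY _] _] := DP h; exact: DhY.
  have [ij|/val_inj ij|ji] := swo_total wo (val i) (val j).
  + have [/(_ i ij) disj _] := YP j.
    by case: (setI0_notin disj (DY _ _ cik Dik) (DY _ _ cjk' Djk')).
  + subst j; have [_ Dtriv] := DP i.
    by apply: Dtriv => //; exists x.
  + have [/(_ j ji) disj _] := YP i.
    by case: (setI0_notin disj (DY _ _ cjk' Djk') (DY _ _ cik Dik)).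
Qed.

End singular_case.

(** * Arbitrary dispersion character *)

Lemma resolution_restrict (X : topologicalType) K K' (Z : set X) (D : K -> set X) :
  [set: K'] #<= [set: K] -> resolution Z D -> exists D' : K' -> set X, resolution Z D'.
Proof.
move=> K'K [DZ ZD Dtriv].
have [K'0|K'0] := pselect ([set: K'] !=set0); last first.
  by exists (fun=> set0); split=> [k|k|k]; case: K'0; exists k.
have [g [_ ginj]] := card_le_inj_on K'K K'0.
exists (D \o g); split=> [k|k|i j _ _ ij]; [exact: DZ|exact: ZD|].
by apply: ginj => //; exact: Dtriv.
Qed.

(** In a nonempty space dense pieces are nonempty, so disjoint ones are distinct and the family has
    size [K]. *)
Lemma resolution_resolvable (X : topologicalType) K (D : K -> set X) :
  [set: X] !=set0 -> resolution setT D -> resolvable X K.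
Proof.
move=> [x _] [_ TD Dtriv]; exists (range D).
have Dmeet k (V : set X) y : open V -> V y -> exists2 z, D k z & V z.
  by move=> oV Vy; exact: closure_meets_open (TD k y I) oV Vy.
have Dinj j k : D j = D k -> j = k.
  move=> jk; apply: Dtriv => //; have [z Djz _] := Dmeet j setT x openT I.
  by exists z; split; rewrite // -jk.
split.
- rewrite /ceq /card_of card_eq_le card_set_type card_set_type_r card_image_le.
  by apply: (@inj_on_card_le _ _ _ _ D) => [k _|j k _ _]; [exists k|exact: Dinj].
- move=> _ [k _ <-] V [y Vy] oV; have [z Dz Vz] := Dmeet k V y oV Vy.
  by exists z.
- by move=> _ _ [j _ <-] [k _ <-] /Dtriv->.
Qed.

Lemma resolution_exists (X : topologicalType) (R Delta : cardinal) :
  regular_cardinal R -> (forall A : set X, discrete_subset A -> small R A) ->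
  [set: R] #<= [set: Delta] ->
  (forall G : set X, open G -> G !=set0 -> [set: Delta] #<= G) ->
  exists D : Delta -> set X, resolution setT D.
Proof.
move=> regR discrR RD DG; apply: resolution_local => W y oW Wy _.
have [|V [oV V0 VW] Vmin] := @card_min X [set V | [/\ open V, V !=set0 & V `<=` W]].
  by exists W; split=> //; exists y.
have DV := DG V oV V0; have RV := card_le_trans RD DV.
have Vsub (G : set X) : open G -> G !=set0 -> G `<=` V -> [set: set_type V] #<= G.
  move=> oG G0 GV; rewrite card_set_type; apply: Vmin; split=> //.
  exact: subset_trans GV VW.
suff [K [Z [D [DK Z0 ZV DP]]]] : exists (K : cardinal) Z (D : K -> set X),
    [/\ [set: Delta] #<= [set: K], Z !=set0, Z `<=` V & resolution Z D].
  have [D' DP'] := resolution_restrict DK DP.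
  by exists Z, D'; split=> // z /ZV/VW.
(* If [V] is at most [R], then [R] itself is the number of pieces; otherwise it is [|V|], which is
   regular or a singular cardinal above [R]. *)
have [VR|RsV] := pselect (V #<= [set: R]).
  have [|Z [D [Z0 ZV DP]]] := regular_resolution regR discrR oV V0.
    by move=> G oG G0 GV; apply: card_le_trans RV _; rewrite -card_set_type; exact: Vsub.
  by exists R, Z, D; split=> //; exact: card_le_trans DV VR.
have DVT : [set: Delta] #<= [set: set_type V] by rewrite card_set_type_r.
have [regV|singV] := pselect (regular_cardinal (set_type V)).
  have [|Z [D [Z0 ZV DP]]] := regular_resolution regV _ oV V0 Vsub.
    by move=> A /discrR; apply: contra_not; rewrite card_set_type; exact: card_le_trans.
  by exists (set_type V), Z, D.
have [||Z [D [Z0 ZV DP]]] := singular_resolution regR discrR oV V0 _ Vsub singV.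
- by rewrite card_set_type_r.
- by rewrite /small card_set_type.
by exists (set_type V), Z, D.
Qed.

(** A least uncountable subset of [K] represents the first uncountable cardinal, which is regular
    because countable unions of countable sets are countable. *)
Lemma aleph1_below (K : cardinal) : clt nat K ->
  exists R : cardinal, [/\ regular_cardinal R, clt nat R & cle R K].
Proof.
move=> [_ Kunc].
have [|A Aunc Amin] := @card_min K [set B | ~ (B #<= [set: nat])]; first by exists setT.
have countable_lt T (S : set T) : S #<= A -> ~ (A #<= S) -> countable S.
  move=> SA nAS; apply: contrapT => Sunc; apply: nAS.
  have [S0|S0] := pselect (S !=set0); last first.
    case: Sunc; suff -> : S = set0 by exact: countable0.
    by apply/seteqP; split=> // x Sx; apply: S0; exists x.
  have [f [_ finj]] := card_le_inj_on SA S0.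
  apply: card_le_trans (card_image_le f S); apply: Amin.
  apply: contra_not Sunc; apply: card_le_trans.
  by apply: (@inj_on_card_le _ _ _ _ f) => // x Sx; exists x.
have natA : [set: nat] #<= A by exact: card_ltW.
exists (set_type A); split; last by rewrite /cle card_set_type card_leT.
- split=> [|I B]; first by rewrite /cle card_set_type_r.
  rewrite /clt /cle card_set_type card_set_type_r => -[IA nAI] BA UB.
  apply: Aunc; rewrite -card_set_type -UB; apply: bigcup_countable => [|i _].
    exact: countable_lt IA nAI.
  have [] := BA i; rewrite /card_of !card_set_type !card_set_type_r.
  exact: countable_lt.
- by split; rewrite /cle ?card_set_type_r ?card_set_type.
Qed.

(** Discreteness is hereditary: a discrete set of size at least [K] would contain one of size
    exactly [s]. *)
Lemma discrete_small (X : topologicalType) (s K : cardinal) (A : set X) :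
  [set: s] #<= [set: K] -> ~ has_discrete_subset_of_size X s -> discrete_subset A ->
  small K A.
Proof.
move=> sK ns dA KA; apply: ns; have sA := card_le_trans sK KA.
have [s0|s0] := pselect ([set: s] !=set0); last first.
  exists set0; split; first by apply: discrete_subsetS dA => x.
  rewrite /ceq /card_of card_eq_le card_set_type card_ge0 card_set_type_r.
  suff -> : [set: s] = set0 by exact: card_ge0.
  by apply/seteqP; split=> // x _; apply: s0; exists x.
have [f [fA finj]] := card_le_inj_on sA s0.
exists (range f); split; first by apply: discrete_subsetS dA => _ [x _ <-]; exact: fA.
rewrite /ceq /card_of card_eq_le card_set_type card_set_type_r card_image_le.
by apply: (@inj_on_card_le _ _ _ _ f) => // x _; exists x.
Qed.

Lemma dispersion_characterP (X : topologicalType) (Delta : cardinal) :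
  is_dispersion_character X Delta -> [set: X] !=set0 /\
  forall G : set X, open G -> G !=set0 -> [set: Delta] #<= G.
Proof.
move=> [[G [_ [x _] _]] Dmin]; split; first by exists x.
move=> {}G oG G0; rewrite -card_set_type_r; apply: Dmin; exists G.
by split=> //; exact: card_eqxx.
Qed.

Theorem theorem2p2 (X : topologicalType) :
  (forall kappa s Delta : cardinal,
     is_hat_s X s -> is_dispersion_character X Delta ->
     regular_cardinal kappa -> cle s kappa -> cle kappa Delta ->
     resolvable X kappa)
  /\
  (forall rs Delta : cardinal,
     is_rs X rs -> is_dispersion_character X Delta ->
     cle rs Delta ->
     maximally_resolvable X)
  /\
  (forall Delta : cardinal,
     is_dispersion_character X Delta ->
     countable_spread X -> clt nat Delta ->
     maximally_resolvable X).
Proof.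
split=> [kappa s Delta [[_ ns] _] /dispersion_characterP[X0 DG] regk sk kD|].
  (* [kappa] serves both as the regular cardinal and as the number of pieces. *)
  have [|D DP] :=
    resolution_exists regk (fun A => @discrete_small X s kappa A sk ns) (card_lexx _).
    by move=> G oG G0; exact: card_le_trans kD (DG G oG G0).
  exact: resolution_resolvable DP.
split=> [rs Delta [[_ regr nrs] _] DX rsD|Delta DX cX /aleph1_below[R [regR [_ Runc] RD]]];
  have [X0 DG] := dispersion_characterP DX; exists Delta => //.
- have [D DP] :=
    resolution_exists regr (fun A => @discrete_small X rs rs A (card_lexx _) nrs) rsD DG.
  exact: resolution_resolvable DP.
- have [|D DP] := resolution_exists regR _ RD DG.
    by move=> A /cX cA; apply: contra_not Runc => RA; exact: card_le_trans RA cA.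
  exact: resolution_resolvable DP.
Qed.
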